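(* Let $d \geq 2$ be an integer and let $p \in \mathbb{R}[x_1, \dots, x_d]$ be a polynomial whose restriction to the unit sphere is $$ p(x)\big|_{\mathbb{S}^{d-1}} = \sum_{k \in S} a_k f_k(x), \qquad f_k \in \mathcal{H}_k^d, \quad a_k \in \mathbb{R},$$ where $S$ is a finite nonempty set of positive integers (so that $p|_{\mathbb{S}^{d-1}}$ has mean value $0$ on $\mathbb{S}^{d-1}$). Then $p\big|_{\mathbb{S}^{d-1}}$ has a zero on each geodesic ball in $\mathbb{S}^{d-1}$ of radius $$ r = \pi^2 d \sum_{k \in S} \frac{1}{k}.$$
   Context: $\mathbb{S}^{d-1}$ is the unit sphere in $\mathbb{R}^d$ with its geodesic (great-circle) distance. $\mathcal{H}_k^d = \{ f \in \mathbb{R}[x_1, \dots, x_d] : f \text{ homogeneous of degree } k \text{ and } \Delta f = 0 \}$ is the space of harmonic polynomials of degree $k$. The geodesic ball $B(x,r)$ is the set of all points on $\mathbb{S}^{d-1}$ whose geodesic distance from $x \in \mathbb{S}^{d-1}$ is at most $r$. The mean value is taken with respect to the surface measure on $\mathbb{S}^{d-1}$. *)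

(* Defs.v *)
(* mpoly must be imported before the MathComp-Analysis files: both declare
   notations at level 2, and the opposite order is rejected. *)
From HB Require Import structures.
From mathcomp Require Import all_boot all_order all_algebra finmap.
From mathcomp Require Import mpoly.
From mathcomp Require Import classical_sets reals trigo.

Set Implicit Arguments.
Unset Strict Implicit.
Unset Printing Implicit Defensive.

Import Order.TTheory GRing.Theory Num.Theory.
Local Open Scope classical_set_scope.
Local Open Scope ring_scope.

(* Points of R^d are row vectors.  The norm that MathComp-Analysis puts on
   'rV[R]_d is the sup norm, hence the explicit Euclidean inner product. *)
Definition dotprod (R : realType) (d : nat) (x y : 'rV[R]_d) : R :=
  \sum_(i < d) x 0 i * y 0 i.

Definition unit_sphere (R : realType) (d : nat) : set 'rV[R]_d :=
  [set x | dotprod x x = 1].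

(* Great-circle distance; meaningful for x, y on the unit sphere, where
   dotprod x y lies in [-1, 1] and acos takes values in [0, pi]. *)
Definition geodesic_dist (R : realType) (d : nat) (x y : 'rV[R]_d) : R :=
  acos (dotprod x y).

Definition geodesic_ball (R : realType) (d : nat) (x : 'rV[R]_d) (r : R) :
    set 'rV[R]_d :=
  [set y | unit_sphere y /\ geodesic_dist x y <= r].

Definition laplacian (R : realType) (d : nat) (f : {mpoly R[d]}) :
    {mpoly R[d]} :=
  \sum_(i < d) f^`M(i)^`M(i).

(* The zero polynomial is k-homogeneous for every k, so this is a vector
   space. *)
Definition harmonic_polys (R : realType) (d k : nat) : set {mpoly R[d]} :=
  [set f | f \is k.-homog /\ laplacian f = 0].
Arguments harmonic_polys : clear implicits.

(* x 0 : 'I_d -> R is the coordinate function of the row vector x. *)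
Definition evalv (R : realType) (d : nat) (f : {mpoly R[d]}) (x : 'rV[R]_d) :
    R :=
  f.@[x 0].

(* Main.v *)
Require Import Defs.
From HB Require Import structures.
From mathcomp Require Import all_boot all_order all_algebra finmap.
From mathcomp Require Import mpoly.
From mathcomp Require Import ring lra.
From mathcomp Require Import boolp classical_sets reals topology normedtype derive trigo.

Set Implicit Arguments.
Unset Strict Implicit.
Unset Printing Implicit Defensive.

Import Order.TTheory GRing.Theory Num.Theory.
Import numFieldTopology.Exports numFieldNormedType.Exports.
Local Open Scope classical_set_scope.
Local Open Scope fset_scope.
Local Open Scope ring_scope.

(* Averaging over the geodesic sphere of radius t multiplies every f in H_k by
   y_k(cos t), where y_k is a normalised Gegenbauer polynomial.  If p > 0 on
   B(x, r) and y_k(cos t) = 0, the average of p is a sum of harmonics of the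
   remaining degrees that is positive on B(x, r - t).  Removing all degrees in
   this way leaves 0 > 0 as soon as r is at least the sum of the radii, so it
   is enough that each y_k(cos t) has a root t <= pi^2 d / k.

   No integral is needed.  The mean over the unit sphere of R^m is Pizzetti's
   sum of iterated Laplacians at 0; it equals the value at 0 of the harmonic
   extension, hence is positive on positive data by the maximum principle.  The
   root of y_k comes from a one-dimensional maximum principle: if y_k > 0 on
   [x0, 1], then (x - x0)^2 / y_k has no possible maximum there. *)

(** * Harmonic extension and Pizzetti's formula *)

Lemma mderiv_dhomog (R : nzRingType) (n d : nat) (p : {mpoly R[n]}) (i : 'I_n) :
  p \is d.-homog -> p^`M(i) \is d.-1.-homog.
Proof.
move=> /dhomogP hp; apply/dhomogP => u; rewrite mcoeff_msupp mcoeff_mderiv => hu.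
have /hp /= : (u + U_(i))%MM \in msupp p.
  by rewrite mcoeff_msupp; apply: contra hu => /eqP ->; rewrite mul0rn.
by rewrite mdegD mdeg1 addn1 => <-.
Qed.

Lemma mderiv_dhomog0 (R : nzRingType) (n : nat) (p : {mpoly R[n]}) (i : 'I_n) :
  p \is 0.-homog -> p^`M(i) = 0.
Proof.
move=> /dhomogP hp; apply/mpolyP => u; rewrite mcoeff_mderiv mcoeff0.
case: (eqVneq p@_(u + U_(i)) 0) => [->|]; first by rewrite mul0rn.
by rewrite -mcoeff_msupp => /hp /=; rewrite mdegD mdeg1 addn1.
Qed.

Lemma submm_eq0 (n : nat) (m : 'X_{1..n}) : (m - m)%MM = 0%MM.
Proof. by apply/mnmP => i; rewrite mnmBE subnn mnm0E. Qed.

Lemma mderivX1 (R : nzRingType) (n : nat) (i j : 'I_n) :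
  ('X_i : {mpoly R[n]})^`M(j) = (i == j)%:R.
Proof.
rewrite mderivX mnm1E; case: eqVneq => [->|_]; last by rewrite scale0r.
by rewrite submm_eq0 mpolyX0 scale1r.
Qed.

Section Laplacian.
Variables (R : realType) (n : nat).
Implicit Types (p q : {mpoly R[n]}).

Lemma laplacian_is_linear : linear (@laplacian R n).
Proof.
move=> a p q; rewrite /laplacian scaler_sumr -big_split /=.
by apply: eq_bigr => i _; rewrite !linearP.
Qed.
HB.instance Definition _ := GRing.isLinear.Build R {mpoly R[n]} {mpoly R[n]} _
  (@laplacian R n) laplacian_is_linear.

Lemma iter_laplacian_is_linear k : linear (iter k (@laplacian R n)).
Proof. by move=> a p q; elim: k => //= k ->; rewrite linearP. Qed.
HB.instance Definition _ k := GRing.isLinear.Build R {mpoly R[n]} {mpoly R[n]} _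
  (iter k (@laplacian R n)) (iter_laplacian_is_linear k).

Definition sqnorm_poly : {mpoly R[n]} := \sum_(i < n) 'X_i * 'X_i.

Definition euler p : {mpoly R[n]} := \sum_(i < n) 'X_i * p^`M(i).

Lemma euler_dhomog d p : p \is d.-homog -> euler p = d%:R *: p.
Proof.
move=> /dhomogP hp; rewrite /euler {1}[p]mpolyE.
under eq_bigr => i _ do rewrite linear_sum mulr_sumr.
rewrite exchange_big /= [in RHS](mpolyE p) scaler_sumr.
rewrite big_seq [RHS]big_seq; apply: eq_bigr => u hu.
under eq_bigr => i _.
  rewrite mderivZ mderivX -!scalerAr.
  have -> : (u i)%:R *: ('X_i * 'X_[u - U_(i)]) = (u i)%:R *: 'X_[u] :> {mpoly R[n]}.
    case: (posnP (u i)) => [->|ui]; first by rewrite !scale0r.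
    by rewrite -mpolyXD addmC submK // lep1mP -lt0n.
  over.
rewrite -scaler_sumr -scaler_suml -natr_sum -mdegE (hp _ hu).
by rewrite scalerA mulrC -scalerA.
Qed.

Lemma mderiv_sqnorm i : sqnorm_poly^`M(i) = 2%:R *: 'X_i.
Proof.
rewrite /sqnorm_poly linear_sum (bigD1 i) //= big1 => [|j ji].
  by rewrite mderivM mderivX mnm1E eqxx scale1r submm_eq0 mpolyX0 mul1r mulr1 addr0
    scaler_nat mulr2n.
by rewrite mderivM mderivX mnm1E (negbTE ji) scale0r mul0r mulr0 addr0.
Qed.

(** The squared norm has gradient [2 x] and Laplacian [2 n]. On homogeneous polynomials of degree
    [d] the last two terms amount to multiplication by [4 d + 2 n]. *)
Lemma laplacian_sqnormM p :
  laplacian (sqnorm_poly * p) =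
  sqnorm_poly * laplacian p + 4%:R *: euler p + (2 * n)%:R *: p.
Proof.
rewrite /laplacian /euler mulr_sumr scaler_sumr.
have -> : (2 * n)%:R *: p = \sum_(i < n) 2%:R *: p.
  by rewrite sumr_const card_ord scalerMnl -mulrnA.
rewrite -!big_split /=; apply: eq_bigr => i _.
rewrite mderivM mderivD !mderivM mderiv_sqnorm mderivZ mderivX1 eqxx.
rewrite !scaler_nat /=. ring.
Qed.

Lemma mderiv_euler i p : (euler p)^`M(i) = euler p^`M(i) + p^`M(i).
Proof.
rewrite /euler linear_sum /=.
under eq_bigr => j _ do rewrite mderivM mderivX1 mderiv_comm.
rewrite big_split /= addrC; congr (_ + _).
rewrite (bigD1 i) //= eqxx mul1r big1 ?addr0 // => j /negbTE ->.
by rewrite mul0r.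
Qed.

Lemma euler_sum (F : 'I_n -> {mpoly R[n]}) :
  euler (\sum_i F i) = \sum_i euler (F i).
Proof.
rewrite /euler exchange_big /=; apply: eq_bigr => i _.
by rewrite linear_sum mulr_sumr.
Qed.

Lemma laplacian_euler p :
  laplacian (euler p) = euler (laplacian p) + 2%:R *: laplacian p.
Proof.
rewrite /laplacian euler_sum scaler_sumr -big_split /=; apply: eq_bigr => i _.
by rewrite mderiv_euler mderivD mderiv_euler scaler_nat; ring.
Qed.

Lemma laplacian_dhomog d p : p \is d.-homog -> laplacian p \is (d - 2).-homog.
Proof.
move=> hp; rewrite /laplacian; apply: rpred_sum => i _.
by rewrite subn2; do 2 apply: mderiv_dhomog.
Qed.

Lemma laplacian_dhomog_lt2 d p : (d < 2)%N -> p \is d.-homog -> laplacian p = 0.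
Proof.
move=> d2 hp; rewrite /laplacian big1 // => i _.
apply: mderiv_dhomog0; have := mderiv_dhomog i hp.
by case: d d2 {hp} => [|[]].
Qed.

(** Taking Laplacians turns the equation into one of the same shape for [v = laplacian q], in degree
    [d - 2] and with constant [a']; then [q] is read off by dividing by [a]. Positivity of the
    constants makes every division legitimate. *)
Lemma sqnorm_laplacian_shift_surj d (a : R) r : 0 < a -> r \is d.-homog ->
  exists2 q, q \is d.-homog & sqnorm_poly * laplacian q + a *: q = r.
Proof.
have [k] := ubnP d; elim: k d a r => // k IH d a r dk a0 hr.
have aU : a \is a GRing.unit by rewrite unitfE gt_eqF.
case: (ltnP d 2) => d2.
  exists (a^-1 *: r); first exact: dhomogZ.
  rewrite linearZ /= (laplacian_dhomog_lt2 d2 hr) scaler0 mulr0 add0r.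
  by rewrite scalerA divrr // scale1r.
pose a' := 4%:R * (d - 2)%:R + (2 * n)%:R + a.
have a'0 : 0 < a' by rewrite ltr_wpDl // addr_ge0 // ?mulr_ge0 // ler0n.
have dk' : (d - 2 < k)%N.
  by rewrite ltn_subLR // addSn addSn add0n; apply: leq_trans dk _.
have [v hv ev] := IH _ _ _ dk' a'0 (laplacian_dhomog hr).
have sv : laplacian (sqnorm_poly * v) + a *: v = laplacian r.
  rewrite laplacian_sqnormM (euler_dhomog hv) -ev -!addrA scalerA -!scalerDl.
  by rewrite !addrA.
(* The candidate really has Laplacian [v], as the ansatz demands. *)
have lq : laplacian (a^-1 *: (r - sqnorm_poly * v)) = v.
  rewrite linearZ linearB /= -sv addrAC subrr add0r.
  by rewrite scalerA mulVr // scale1r.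
exists (a^-1 *: (r - sqnorm_poly * v)).
  apply: dhomogZ; apply: rpredB => //.
  rewrite -(subnKC d2); apply: dhomogM => //.
  rewrite /sqnorm_poly; apply: rpred_sum => i _.
  by rewrite -[2%N]/(1 + 1)%N; apply: dhomogM; rewrite dhomogX /= mdeg1.
by rewrite lq scalerA divrr // scale1r addrC subrK.
Qed.

(* Solvability of the Dirichlet problem on the unit ball. *)
Lemma laplacian_dirichlet_surj r : (0 < n)%N ->
  exists q, laplacian ((sqnorm_poly - 1) * q) = r.
Proof.
move=> n0; suff H d p : p \is d.-homog ->
    exists q, laplacian ((sqnorm_poly - 1) * q) = p.
  elim/mpolyind: r => [|c u p _ _ [q IH]].
    by exists 0; rewrite mulr0 linear0.
  have /H [q' hq'] : (c *: 'X_[u] : {mpoly R[n]}) \is (mdeg u).-homog.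
    by apply: dhomogZ; rewrite dhomogX.
  by exists (q' + q); rewrite mulrDr linearD /= IH hq'.
have [k] := ubnP d; elim: k d p => // k IH d p dk hp.
have a0 : 0 < 4%:R * d%:R + (2 * n)%:R :> R.
  by rewrite ltr_wpDl ?mulr_ge0 ?ler0n // ltr0n muln_gt0.
(* With this constant the shifted operator is [q |-> laplacian (sqnorm_poly * q)] in degree [d]. The
   error [- laplacian q] has degree [d - 2] and is corrected by the induction hypothesis. *)
have [q hq eq] := sqnorm_laplacian_shift_surj a0 hp.
have eq' : laplacian (sqnorm_poly * q) = p.
  rewrite laplacian_sqnormM (euler_dhomog hq) -eq -addrA scalerA -scalerDl //.
have [d2|d2] := ltnP d 2.
  by exists q; rewrite mulrBl mul1r linearB /= eq' (laplacian_dhomog_lt2 d2 hq) subr0.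
have dk' : (d - 2 < k)%N.
  by rewrite ltn_subLR // addSn addSn add0n; apply: leq_trans dk _.
have [q1 hq1] := IH _ _ dk' (laplacian_dhomog hq).
exists (q + q1); rewrite mulrDr linearD /= hq1 mulrBl mul1r linearB /= eq'.
by rewrite subrK.
Qed.

(** Each commutation of the Laplacian with the Euler operator adds [2 laplacian]. At the origin only
    the last term survives, and its factor is the ratio of consecutive Pizzetti denominators. *)
Lemma iter_laplacian_sqnormM j p :
  iter j.+1 (@laplacian R n) (sqnorm_poly * p) =
  sqnorm_poly * iter j.+1 (@laplacian R n) p
  + (4 * j.+1)%:R *: euler (iter j (@laplacian R n) p)
  + (2 * j.+1 * (n + 2 * j))%:R *: iter j (@laplacian R n) p.
Proof.
elim: j => [|j IH].
  by rewrite /= laplacian_sqnormM !muln1 muln0 addn0.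
rewrite iterS IH !linearD !linearZ /= laplacian_sqnormM laplacian_euler.
set A := laplacian (iter j _ p).
rewrite scalerDr scalerA -!addrA; congr (_ + _).
rewrite [X in _ + X = _]addrCA [LHS]addrA -!scalerDl.
congr (_ *: _ + _ *: _); rewrite !natrM ?natrD ?natrM -!natr1; ring.
Qed.

Lemma iter_laplacian_dhomog d p N : p \is d.-homog -> (d < N)%N ->
  iter N (@laplacian R n) p = 0.
Proof.
elim: N d p => // N IH d p hp dN; rewrite iterSr.
have [d2|d2] := ltnP d 2; first by rewrite (laplacian_dhomog_lt2 d2 hp) linear0.
apply: IH (laplacian_dhomog hp) _; rewrite ltn_subLR //.
by rewrite addSn addSn add0n; apply: leq_trans dN _.
Qed.

Lemma iter_laplacian_eventually0 p :
  exists N0, forall N, (N0 <= N)%N -> iter N (@laplacian R n) p = 0.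
Proof.
elim/mpolyind: p => [|c u p _ _ [N0 IH]]; first by exists 0 => N _; rewrite linear0.
exists (maxn N0 (mdeg u).+1) => N; rewrite geq_max => /andP[NN0 uN].
rewrite linearD /= IH // addr0; apply: iter_laplacian_dhomog uN.
by apply: dhomogZ; rewrite dhomogX.
Qed.

(** The denominator [2^j j! n (n+2) ... (n+2j-2)] of Pizzetti's series. *)
Definition pizzetti_coef (j : nat) : R :=
  \prod_(i < j) (2 * i.+1 * (n + 2 * i))%:R.

(* Pizzetti's formula for the mean value over the unit sphere of R^n, cut off
   after N terms. *)
Definition pizzetti N p : R :=
  \sum_(j < N) (iter j (@laplacian R n) p).@[fun=> 0] / pizzetti_coef j.

Lemma pizzetti_is_linear N : linear_for *%R (pizzetti N).
Proof.
move=> a p q; rewrite /pizzetti mulr_sumr -big_split /=; apply: eq_bigr => j _.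
by rewrite linearP /= mevalD mevalZ mulrDl mulrA.
Qed.
HB.instance Definition _ N := GRing.isLinear.Build R {mpoly R[n]} R _
  (pizzetti N) (pizzetti_is_linear N).

Lemma pizzetti_coefS j :
  pizzetti_coef j.+1 = pizzetti_coef j * (2 * j.+1 * (n + 2 * j))%:R.
Proof. by rewrite /pizzetti_coef big_ord_recr. Qed.

Lemma pizzetti_coef_gt0 j : (0 < n)%N -> 0 < pizzetti_coef j.
Proof.
by move=> n0; apply: prodr_gt0 => i _; rewrite ltr0n !muln_gt0 /= addn_gt0 n0.
Qed.

(** A mean over the unit sphere must not see the factor [|x|^2]. The cut-off shifts because order
    [j+1] of the product gives order [j] of [p]. *)
Lemma pizzetti_sqnormM N p : (0 < n)%N ->
  pizzetti N.+1 (sqnorm_poly * p) = pizzetti N p.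
Proof.
move=> n0; rewrite /pizzetti big_ord_recl /=.
have s0 : sqnorm_poly.@[fun=> 0] = 0.
  by rewrite /sqnorm_poly raddf_sum big1 //= => i _; rewrite mevalM mevalXU mul0r.
have e0 q : (euler q).@[fun=> 0] = 0.
  by rewrite /euler raddf_sum big1 //= => i _; rewrite mevalM mevalXU mul0r.
rewrite mevalM s0 mul0r mul0r add0r; apply: eq_bigr => j _.
rewrite [X in X.@[_]]iter_laplacian_sqnormM !mevalD mevalM s0 mul0r add0r.
rewrite !mevalZ e0 mulr0 add0r pizzetti_coefS.
rewrite invfM mulrA mulrAC; congr (_ / _).
rewrite mulrC mulrA mulVf ?mul1r //.
by rewrite pnatr_eq0 -lt0n !muln_gt0 /= addn_gt0 n0.
Qed.

Lemma pizzetti_harmonic N p : laplacian p = 0 -> (0 < N)%N ->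
  pizzetti N p = p.@[fun=> 0].
Proof.
case: N => // N hp _; rewrite /pizzetti big_ord_recl /= /pizzetti_coef big_ord0 divr1.
rewrite big1 ?addr0 // => j _.
by rewrite -iterS iterSr hp linear0 meval0 mul0r.
Qed.

(* The mean value over the unit sphere is the value at the origin of the
   harmonic extension. *)
Lemma pizzetti_dirichlet p : (0 < n)%N ->
  exists h N0, [/\ laplacian h = 0,
    forall v, sqnorm_poly.@[v] = 1 -> h.@[v] = p.@[v] &
    forall N, (N0 <= N)%N -> pizzetti N p = h.@[fun=> 0]].
Proof.
(* Subtracting [(|x|^2 - 1) q] makes [p] harmonic without changing it on the sphere. *)
move=> n0; have [q hq] := laplacian_dirichlet_surj (laplacian p) n0.
have [N0 hN0] := iter_laplacian_eventually0 q.
exists (p - (sqnorm_poly - 1) * q), N0.+1.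
have hl : laplacian (p - (sqnorm_poly - 1) * q) = 0 by rewrite linearB /= hq subrr.
split=> // [v hv|[//|N] NN0].
  by rewrite mevalB mevalM mevalB hv meval1 subrr mul0r subr0.
rewrite -(pizzetti_harmonic hl (ltn0Sn N)) linearB /= mulrBl mul1r linearB /=.
(* Past the cut-off the extra term of the sum vanishes, so the two halves of [(|x|^2 - 1) q] have
   equal means and cancel. *)
have eN : pizzetti N.+1 q = pizzetti N q.
  by rewrite /pizzetti big_ord_recr /= hN0 // meval0 mul0r addr0.
by rewrite pizzetti_sqnormM // eN subrr subr0.
Qed.

End Laplacian.

(** * The maximum principle *)

(** Both sides agree on constants and variables and are compatible with sums and products. An
    abstract derivation [D] serves restrictions to lines, with values in [{poly R}], and to
    hyperplanes, with values in [{mpoly R[m]}]. *)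
Lemma mmap_chain_rule (R A : comNzRingType) (n : nat) (c : {rmorphism R -> A})
    (h : 'I_n -> A) (D : {additive A -> A}) (p : {mpoly R[n]}) :
    (forall a b, D (a * b) = D a * b + a * D b) -> (forall x, D (c x) = 0) ->
  D (mmap c h p) = \sum_i mmap c h p^`M(i) * D (h i).
Proof.
move=> DM DC.
pose P p := D (mmap c h p) = \sum_i mmap c h p^`M(i) * D (h i).
have PC x : P x%:MP.
  rewrite /P mmapC DC big1 // => i _.
  by rewrite mderivC raddf0 mul0r.
have PD q r : P q -> P r -> P (q + r).
  move=> hq hr; rewrite /P !raddfD /= hq hr -big_split /=.
  by apply: eq_bigr => i _; rewrite !raddfD /= mulrDl.
have PM q r : P q -> P r -> P (q * r).
  move=> hq hr; rewrite /P rmorphM DM hq hr mulr_suml mulr_sumr -big_split /=.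
  by apply: eq_bigr => i _; rewrite mderivM rmorphD !rmorphM /=; ring.
have PX i : P 'X_i.
  rewrite /P mmapX mmap1U (bigD1 i) //= mderivX1 eqxx rmorph1 mul1r.
  rewrite big1 ?addr0 // => j ji.
  by rewrite mderivX1 eq_sym (negbTE ji) rmorph0 mul0r.
rewrite -/(P p); elim/mpolyind: p => [|x u p _ _ IH].
  by rewrite -mpolyC0; exact: PC.
apply: PD IH; rewrite -mul_mpolyC; apply: (PM _ _ (PC _)).
rewrite mpolyXE_id; apply: (big_ind P) => [||i _]; [exact: PC|exact: PM|].
by elim: (u i) => [|k IH]; [rewrite expr0; exact: PC|rewrite exprS; exact: (PM)].
Qed.

Lemma horner_mmap (R : comNzRingType) (n : nat) (h : 'I_n -> {poly R})
    (p : {mpoly R[n]}) (t : R) :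
  (mmap (@polyC R) h p).[t] = p.@[fun i => (h i).[t]].
Proof.
rewrite mevalE /mmap horner_sum; apply: eq_bigr => u _.
rewrite hornerM hornerC /mmap1 horner_prod; congr (_ * _).
by apply: eq_bigr => i _; rewrite horner_exp.
Qed.

Lemma deriv_mmap (R : comNzRingType) (n : nat) (h : 'I_n -> {poly R})
    (p : {mpoly R[n]}) :
  (mmap (@polyC R) h p)^`() = \sum_i mmap (@polyC R) h p^`M(i) * (h i)^`().
Proof.
apply: (@mmap_chain_rule R {poly R} n (@polyC R) h (@deriv R)); first exact: derivM.
by move=> x; exact: derivC.
Qed.

Section UnivariateMinimum.
Variable R : realType.
Implicit Types (q : {poly R}) (e : R).

Lemma horner_ge0_right q e : 0 < e ->
  (forall t, 0 < t < e -> 0 <= q.[t]) -> 0 <= q.[0].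
Proof.
move=> e0 hq; rewrite leNgt; apply/negP => q0.
have /cvgrPdist_lt /(_ (- q.[0])) := @continuous_horner R q 0.
rewrite oppr_gt0 => /(_ q0) /nbhs_ballP [d /= d0 hd].
pose t := Num.min d e / 2.
have m0 : 0 < Num.min d e by rewrite lt_min d0.
have t0 : 0 < t by rewrite divr_gt0.
have tm : t < Num.min d e by rewrite /t ltr_pdivrMr // ltr_pMr // ltr1n.
move: tm; rewrite lt_min => /andP[td te].
have := hd t; rewrite /ball /= sub0r normrN gtr0_norm // => /(_ td).
have := hq t; rewrite t0 te => /(_ isT) h1.
by rewrite ltr_norml => /andP[h2 _]; lra.
Qed.

(** Write [q - q(0) = A X]: the derivative at 0 is [A(0)], and [A] is nonnegative to the right of 0.
    The one-sided form is what endpoint minima require. *)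
Lemma deriv_ge0_min_right q e : 0 < e ->
  (forall t, 0 < t < e -> q.[0] <= q.[t]) -> 0 <= q^`().[0].
Proof.
move=> e0 hq; have : root (q - q.[0]%:P) 0 by rewrite /root !hornerE subrr.
move=> /factor_theorem [A hA].
have -> : q^`().[0] = A.[0].
  have -> : q = A * ('X - 0%:P) + q.[0]%:P by rewrite -hA subrK.
  by rewrite derivD derivC addr0 derivM derivXsubC !hornerE; ring.
apply: (horner_ge0_right e0) => t /andP[t0 te].
have := hq t; rewrite t0 te => /(_ isT).
rewrite -subr_ge0 -[q.[0] in X in X -> _](hornerC _ t) -hornerN -hornerD hA.
by rewrite !hornerE subr0 pmulr_lge0.
Qed.

Lemma deriv_le0_min_left q e : 0 < e ->
  (forall t, 0 < t < e -> q.[0] <= q.[- t]) -> q^`().[0] <= 0.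
Proof.
move=> e0 hq.
have := @deriv_ge0_min_right (q \Po (- 'X)) e e0.
rewrite deriv_comp derivN derivX mulrN1 hornerN !horner_comp !hornerE oppr0.
rewrite oppr_ge0; apply => t ht.
by rewrite horner_comp !hornerE; apply: hq.
Qed.

(** Once the derivative vanishes, [X] can be factored out twice: [q = q(0) + B X^2], and the second
    derivative at 0 is [2 B(0)]. *)
Lemma deriv_min q e : 0 < e -> (forall t, `|t| < e -> q.[0] <= q.[t]) ->
  q^`().[0] = 0 /\ 0 <= q^`()^`().[0].
Proof.
move=> e0 hq; have d0 : q^`().[0] = 0.
  apply/eqP; rewrite eq_le (deriv_ge0_min_right e0) ?(deriv_le0_min_left e0) //;
    by move=> t /andP[t0 te]; apply: hq; rewrite ?normrN gtr0_norm.
split=> //.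
have : root (q - q.[0]%:P) 0 by rewrite /root !hornerE subrr.
move=> /factor_theorem [A hA].
have qA : q = A * ('X - 0%:P) + q.[0]%:P by rewrite -hA subrK.
have A0 : root A 0.
  move: d0; rewrite qA derivD derivC addr0 derivM derivXsubC !hornerE.
  by rewrite oppr0 mulr0 add0r /root => ->.
move: A0 => /factor_theorem [B hB].
rewrite subr0 in hB qA hA.
have dB : q^`()^`().[0] = 2 * B.[0].
  rewrite qA hB !(derivD, derivM, derivC, derivX) !hornerE.
  by rewrite /= addr0 mulr_natl mulr2n.
rewrite dB mulr_ge0 //; apply: (horner_ge0_right e0) => t /andP[t0 te].
have := hq t; rewrite gtr0_norm // => /(_ te).
rewrite [X in X.[t]]qA hB !hornerE lerDr -mulrA pmulr_lge0 //.
by rewrite mulr_gt0.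
Qed.

End UnivariateMinimum.

Section EvalContinuity.
Variables (R : realType) (n : nat).

(** The domain [T] is arbitrary so as to cover both row vectors and a parametrised arc. *)
Lemma continuous_meval (T : topologicalType) (h : T -> 'I_n -> R)
    (p : {mpoly R[n]}) (x : T) :
  (forall i, {for x, continuous (h^~ i)}) ->
  {for x, continuous (fun y => p.@[h y])}.
Proof.
move=> ch; elim/mpolyind: p => [|c u p _ _ IH].
  rewrite (_ : (fun y => _) = fun=> 0); first exact: cst_continuous.
  by apply/funext => y; rewrite meval0.
rewrite (_ : (fun y => _) =
    fun y => c * \prod_i h y i ^+ u i + p.@[h y]); last first.
  by apply/funext => y; rewrite mevalD mevalZ mevalX.
apply: continuousD IH; apply: continuousM; first exact: cst_continuous.
apply: cvg_big => [|i _]; first exact: mul_continuous.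
elim: (u i) => [|k IHk]; first exact: cst_continuous.
rewrite exprS; under eq_cvg do rewrite exprS.
by apply: cvgM IHk; exact: ch.
Qed.


Lemma continuous_evalv (p : {mpoly R[n]}) : continuous (evalv p).
Proof.
by move=> x; apply: continuous_meval => i; apply: coord_continuous.
Qed.

End EvalContinuity.

Section MeanPositivity.
Variables (R : realType) (n : nat).
Implicit Types (p h : {mpoly R[n]}) (x z : 'rV[R]_n).

Lemma evalv_sqnorm x : evalv (sqnorm_poly R n) x = dotprod x x.
Proof.
rewrite /evalv /sqnorm_poly raddf_sum; apply: eq_bigr => i _ /=.
by rewrite mevalM mevalXU.
Qed.

Lemma dotprod_ge0 x : 0 <= dotprod x x.
Proof. by apply: sumr_ge0 => i _; rewrite -expr2 sqr_ge0. Qed.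

Lemma sqr_coord_le_dotprod x i : x 0 i ^+ 2 <= dotprod x x.
Proof.
rewrite /dotprod (bigD1 i) //= expr2 lerDl.
by apply: sumr_ge0 => j _; rewrite -expr2 sqr_ge0.
Qed.

Lemma compact_unit_ball : compact [set x : 'rV[R]_n | dotprod x x <= 1].
Proof.
apply: bounded_closed_compact.
  exists 1; split=> // M M1 x /= hx.
  apply: le_trans (ltW M1); rewrite [leLHS]/Num.norm /= mx_normrE.
  apply: bigmax_le => // -[i j] _ /=; rewrite ord1.
  rewrite -(@expr_le1 _ 2) // real_normK ?num_real //.
  exact: le_trans (sqr_coord_le_dotprod x j) hx.
rewrite (_ : [set x : 'rV[R]_n | _] = evalv (sqnorm_poly R n) @^-1` [set y | y <= 1]).
  by apply: preimage_closed; [move=> ? _; apply: continuous_evalv|exact: closed_le].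
by apply/seteqP; split => x /=; rewrite evalv_sqnorm.
Qed.

Lemma compact_unit_sphere : compact (@unit_sphere R n).
Proof.
apply: subclosed_compact compact_unit_ball _.
  rewrite (_ : @unit_sphere R n = evalv (sqnorm_poly R n) @^-1` [set y | y = 1]).
    by apply: preimage_closed; [move=> ? _; apply: continuous_evalv|exact: closed_eq].
  by apply/seteqP; split => x /=; rewrite /unit_sphere /= evalv_sqnorm.
by move=> x; rewrite /unit_sphere /= => ->.
Qed.

Lemma evalv_min p (A : set 'rV[R]_n) : A !=set0 -> compact A ->
  exists2 z, A z & forall x, A x -> evalv p z <= evalv p x.
Proof.
move=> A0 cA; have [|z zA hz] := @EVT_min_rV R n (evalv p) A A0 cA.
  by apply: continuous_subspaceT; exact: continuous_evalv.
by exists z => [|x xA]; [exact: set_mem|apply: hz; rewrite inE].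
Qed.

Lemma laplacian_sqnorm : laplacian (sqnorm_poly R n) = (2 * n)%:R%:MP.
Proof.
have := laplacian_sqnormM (1 : {mpoly R[n]}).
have e1 : euler (1 : {mpoly R[n]}) = 0.
  by rewrite /euler big1 // => i _; rewrite -mpolyC1 mderivC mulr0.
have l1 : laplacian (1 : {mpoly R[n]}) = 0.
  by rewrite /laplacian big1 // => i _; rewrite -mpolyC1 mderivC mderiv0.
by rewrite e1 l1 !mulr1 mulr0 scaler0 !add0r => ->; rewrite -mul_mpolyC mulr1.
Qed.

Lemma laplacian_ge0_interior_min p z : dotprod z z < 1 ->
  (forall x, dotprod x x <= 1 -> evalv p z <= evalv p x) ->
  0 <= evalv (laplacian p) z.
Proof.
move=> z1 hmin; rewrite /evalv /laplacian raddf_sum; apply: sumr_ge0 => i _ /=.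
pose h j : {poly R} := (z 0 j)%:P + (i == j)%:R *: 'X.
have dh q : (mmap (@polyC R) h q)^`() = mmap (@polyC R) h q^`M(i).
  rewrite deriv_mmap (bigD1 i) //= {2}/h eqxx derivD derivC derivZ derivX add0r.
  rewrite scale1r mulr1 big1 ?addr0 // => j ji.
  by rewrite /h eq_sym (negbTE ji) derivD derivC derivZ scale0r addr0 mulr0.
have evh q t : (mmap (@polyC R) h q).[t] =
    evalv q (\row_j (z 0 j + (i == j)%:R * t)).
  rewrite horner_mmap /evalv; apply: meval_eq => j.
  by rewrite mxE /h !hornerE.
have row0 : \row_j (z 0 j + (i == j)%:R * 0) = z.
  by apply/rowP => j; rewrite mxE mulr0 addr0.
have dotrow t : dotprod (\row_j (z 0 j + (i == j)%:R * t))
    (\row_j (z 0 j + (i == j)%:R * t)) = dotprod z z + 2 * t * z 0 i + t ^+ 2.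
  rewrite /dotprod (bigD1 i) //= [\sum_i z 0 i * z 0 i](bigD1 i) //= !mxE eqxx.
  rewrite (eq_bigr (fun j => z 0 j * z 0 j)); first by rewrite /= mul1r; ring.
  by move=> j ji; rewrite mxE eq_sym (negbTE ji) mul0r addr0.
(* For [|t| < (1 - |z|^2) / 3] the point [z + t e_i] stays in the ball, since its squared norm is at
   most [|z|^2 + 2 |t| + t^2 <= |z|^2 + 3 |t|]. *)
have := @deriv_min R (mmap (@polyC R) h p) ((1 - dotprod z z) / 3).
rewrite !dh !evh row0 divr_gt0 ?subr_gt0 // => /(_ isT)[] // t ht.
rewrite evh; apply: hmin; rewrite dotrow.
have zi : `|z 0 i| <= 1.
  rewrite -(@expr_le1 _ 2) // real_normK ?num_real //.
  exact: le_trans (sqr_coord_le_dotprod z i) (ltW z1).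
have t3 : 2 * t * z 0 i <= 2 * `|t|.
  by apply: le_trans (ler_norm _) _; rewrite !normrM ger0_norm // ler_piMr // mulr_ge0.
have t1 : `|t| <= 1 by have := dotprod_ge0 z; lra.
have t2 : t ^+ 2 <= `|t| by rewrite -real_normK ?num_real // expr2 ler_piMl.
lra.
Qed.

(** Subtracting [e |x|^2] makes the Laplacian strictly negative, which excludes an interior minimum.
    With [e] half the minimum over the sphere, boundary values remain at least [e > 0], so a value
    at most 0 at the origin is contradictory. *)
Lemma harmonic_gt0_origin h : (0 < n)%N -> laplacian h = 0 ->
  (forall x, unit_sphere x -> 0 < evalv h x) -> 0 < evalv h 0.
Proof.
move=> n0 hl hpos.
have sphere0 : @unit_sphere R n !=set0.
  exists (delta_mx 0 (Ordinal n0)); rewrite /unit_sphere /= /dotprod.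
  rewrite (bigD1 (Ordinal n0)) //= !mxE !eqxx mulr1 big1 ?addr0 // => j jn.
  by rewrite mxE (negbTE jn) andbF mul0r.
have [s hs smin] := evalv_min h sphere0 compact_unit_sphere.
rewrite ltNge; apply/negP => h0.
have e0 : 0 < evalv h s / 2 by rewrite divr_gt0 // hpos.
set e := evalv h s / 2 in e0.
pose u := h - e *: sqnorm_poly R n.
have evu x : evalv u x = evalv h x - e * dotprod x x.
  by rewrite -evalv_sqnorm /evalv /u mevalB mevalZ.
have ball0 : [set x : 'rV[R]_n | dotprod x x <= 1] !=set0.
  exists 0 => /=; rewrite /dotprod big1 // => i _; by rewrite mxE mul0r.
have [z /= hz zmin] := evalv_min u ball0 compact_unit_ball.
have [z1|] := ltP (dotprod z z) 1.
  have := laplacian_ge0_interior_min z1 zmin.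
  rewrite /u linearB linearZ /= hl laplacian_sqnorm sub0r /evalv mevalN mevalZ mevalC.
  by rewrite oppr_ge0 leNgt mulr_gt0 // ltr0n muln_gt0.
move=> z1; have zz1 : dotprod z z = 1 by apply/eqP; rewrite eq_le hz z1.
have d0 : dotprod (0 : 'rV[R]_n) 0 = 0.
  by rewrite /dotprod big1 // => i _; rewrite mxE mul0r.
have := zmin 0; rewrite d0 ler01 => /(_ isT).
rewrite !evu zz1 d0 mulr0 mulr1 subr0 => hz0.
have := smin z zz1; rewrite /e in hz0 e0; lra.
Qed.

Lemma pizzetti_gt0 p : (0 < n)%N ->
  (forall x, unit_sphere x -> 0 < evalv p x) ->
  exists N0, forall N, (N0 <= N)%N -> 0 < pizzetti N p.
Proof.
move=> n0 hp; have [h [N0 [hl hE hN]]] := pizzetti_dirichlet p n0.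
exists N0 => N /hN ->.
have -> : h.@[fun=> 0] = evalv h 0 by apply: meval_eq => i; rewrite mxE.
apply: harmonic_gt0_origin => // x hx.
have -> : evalv h x = evalv p x by apply: hE; rewrite -/(evalv _ x) evalv_sqnorm.
exact: hp.
Qed.

End MeanPositivity.

(** * Gegenbauer polynomials *)

Section ZonalPolynomial.
Variables (R : realType) (m : nat).
Hypothesis m_gt0 : (0 < m)%N.

Local Notation w := (1 - 'X * 'X : {poly R}).

(** The cut-off [N] is free so that the differential equation can be proved by induction on it. *)
Definition zonal_trunc (k N : nat) : {poly R} :=
  \sum_(j < N) ((-1) ^+ j / pizzetti_coef R m j)%:P *
    (w ^+ j * ('X^k)^`(2 * j)).

(* The polynomial y with y(1) = 1 such that y(cos t) f(z) is the mean of a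
   degree k harmonic polynomial f over the geodesic sphere of radius t around z
   (a normalised Gegenbauer polynomial): it is what Pizzetti's formula gives. *)
Definition zonal (k : nat) : {poly R} := zonal_trunc k k.+1.

(** The Laplace-Beltrami operator of the unit sphere of [R^(m+1)] on functions of the height
    [x = <z, u>]; degree [k] harmonics have eigenvalue [- k (k + m - 1)]. *)
Definition legendre_op (v : {poly R}) : {poly R} :=
  w * v^`()^`() - m%:R * ('X * v^`()).

Lemma legendre_opD u v : legendre_op (u + v) = legendre_op u + legendre_op v.
Proof. rewrite /legendre_op !derivD; ring. Qed.

Lemma legendre_opCM c v : legendre_op (c%:P * v) = c%:P * legendre_op v.
Proof. by rewrite /legendre_op !mul_polyC !derivZ -!mul_polyC; ring. Qed.

(** Euler's identity in degree [k - n]. The difference is taken in the ring, so the case [n > k] is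
    covered too: both sides are then 0. *)
Lemma mulX_derivn_Xn k n :
  'X * ('X^k)^`(n.+1) = (k%:R - n%:R) * ('X^k)^`(n) :> {poly R}.
Proof.
elim: n => [|n IH].
  rewrite derivn1 derivn0 derivXn subr0 mulr_natl.
  by case: k => [|k]; rewrite ?mulr0n ?mulr0 // mulrnAr -exprS.
have := congr1 (@deriv R) IH; rewrite derivM derivX mul1r -!derivnS.
rewrite derivM derivB -!polyC_natr !derivC subrr mul0r add0r -!derivnS !polyC_natr => IH'.
have -> : 'X * ('X^k)^`(n.+2) =
    (k%:R - n%:R) * ('X^k)^`(n.+1) - ('X^k)^`(n.+1) :> {poly R}.
  by rewrite -IH' addrAC subrr add0r.
rewrite -[n.+1%:R]natr1; ring.
Qed.

Lemma mulXX_derivn_Xn k n :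
  'X * 'X * ('X^k)^`(n.+2) =
  (k%:R - n%:R) * (k%:R - n%:R - 1) * ('X^k)^`(n) :> {poly R}.
Proof.
rewrite -mulrA mulX_derivn_Xn -natr1.
rewrite mulrCA mulX_derivn_Xn; ring.
Qed.

(** The first summand lowers the power of [1 - X^2] by one; this drives the telescoping of the zonal
    sum. *)
Lemma legendre_op_expM j (g : {poly R}) :
  legendre_op (w ^+ j.+1 * g) =
  (2 * j.+1 * (m + 2 * j))%:R * (w ^+ j * g)
  - (2 * j.+1 * (m + 2 * j) + 2 * j.+1)%:R * (w ^+ j.+1 * g)
  - (4 * j.+1 + m)%:R * (w ^+ j.+1 * ('X * g^`()))
  + w ^+ j.+2 * g^`()^`().
Proof.
have dw : w^`() = - (2%:R * 'X).
  by rewrite derivB derivC sub0r derivM derivX; ring.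
have hP : w * (w ^+ j.-1 *+ j) = j%:R * w ^+ j.
  by case: j => [|j] /=; rewrite ?mulr0n ?mulr0 ?mul0r // mulrnAr -exprS mulr_natl.
have hW : (w ^+ j)^`() = - (2%:R * 'X) * (w ^+ j.-1 *+ j).
  by rewrite deriv_exp dw mulrnAr.
have hX : 'X * 'X = 1 - w by rewrite opprB addrC subrK.
rewrite /legendre_op [w ^+ j.+2]exprS [w ^+ j.+1]exprS.
(* Powers with a symbolic exponent become free variables subject to [hP] and [hX]; each identity is
   then a multiple of one of these relations. *)
move: w (w ^+ j) (w ^+ j.-1 *+ j) dw hP hW hX => u W P dw hP hW hX.
have dn (k : nat) : (k%:R : {poly R})^`() = 0 by rewrite -polyC_natr derivC.
have d1 : (u * W * g)^`() = - (2 * j.+1)%:R * ('X * W * g) + u * W * g^`().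
  rewrite !derivM dw hW -natr1.
  transitivity (- 2%:R * 'X * W * g - 2%:R * 'X * (u * P) * g + u * W * g^`()).
    by ring.
  rewrite hP natrM -natr1; ring.
have d2 : u * (u * W * g)^`()^`() = - (2 * j.+1)%:R * (u * W * g)
    + (4 * j.+1 * j)%:R * ('X * 'X * W * g)
    - (4 * j.+1)%:R * (u * W * ('X * g^`())) + u * (u * W) * g^`()^`().
  rewrite d1 !(derivD, derivN, derivM, derivX) dw hW dn.
  rewrite !natrM -natr1.
  have eP : u * P - j%:R * W = 0 by rewrite hP subrr.
  apply/eqP; rewrite -subr_eq0; apply/eqP.
  transitivity ((4%:R * (j%:R + 1) * ('X * 'X) * g - 2%:R * 'X * u * g^`())
      * (u * P - j%:R * W)).
    ring.
  by rewrite eP mulr0.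
rewrite d2 d1 !(natrD, natrM) -natr1.
have eX : 'X * 'X - (1 - u) = 0 by rewrite hX subrr.
apply/eqP; rewrite -subr_eq0; apply/eqP.
transitivity ((4%:R * (j%:R + 1) * j%:R + 2%:R * (j%:R + 1) * m%:R) * (W * g)
    * ('X * 'X - (1 - u))).
  ring.
by rewrite eX mulr0.
Qed.

Lemma zonal_truncS k N :
  zonal_trunc k N.+1 = zonal_trunc k N +
    ((-1) ^+ N / pizzetti_coef R m N)%:P * (w ^+ N * ('X^k)^`(2 * N)).
Proof. by rewrite /zonal_trunc big_ord_recr. Qed.

(** The sum telescopes: by the recursion of [pizzetti_coef], the lowest power produced by the new
    term cancels the previous remainder. The remainder is a derivative of ['X^k] that vanishes for
    large [N]. *)
Lemma legendre_op_zonal_trunc k N :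
  legendre_op (zonal_trunc k N.+1) + k%:R * (k%:R + m%:R - 1) * zonal_trunc k N.+1 =
  ((-1) ^+ N / pizzetti_coef R m N)%:P * (w ^+ N * ('X^k)^`(2 * N.+1)).
Proof.
elim: N => [|N IH].
  rewrite /zonal_trunc big_ord_recl big_ord0 addr0 /= /pizzetti_coef big_ord0.
  rewrite divr1 !expr0 !mul1r /legendre_op.
  have h1 := mulX_derivn_Xn k 0; have h2 := mulXX_derivn_Xn k 0.
  rewrite derivn0 subr0 in h1 h2.
  rewrite -[('X^k)^`()]/('X^k)^`(1) -[('X^k)^`(1)^`()]/('X^k)^`(2) h1.
  by rewrite mulrBl h2; ring.
rewrite [zonal_trunc k N.+2]zonal_truncS legendre_opD mulrDr addrACA IH.
rewrite legendre_opCM legendre_op_expM.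
have h1 := mulX_derivn_Xn k (2 * N.+1).
have h2 := mulXX_derivn_Xn k (2 * N.+1).
rewrite [(2 * N.+2)%N]mulnS.
rewrite -[('X^k)^`(2 + _)]/('X^k)^`((2 * N.+1).+2) -!derivnS h1.
move: (('X^k)^`(2 * N.+1)) (('X^k)^`((2 * N.+1).+2)) h2 {h1 IH} => g g2 h2.
have hw : w * (w * w ^+ N) * g2 = w * w ^+ N * g2 - w * w ^+ N * ('X * 'X * g2) by ring.
rewrite !exprS hw h2.
set A := (2 * N.+1 * (m + 2 * N))%N.
have hA : ((-1) * (-1) ^+ N / pizzetti_coef R m N.+1)%:P * A%:R +
    ((-1) ^+ N / pizzetti_coef R m N)%:P = 0 :> {poly R}.
  rewrite -polyC_natr -polyCM -polyCD pizzetti_coefS -/A.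
  have A0 : A%:R != 0 :> R by rewrite pnatr_eq0 -lt0n !muln_gt0 /= addn_gt0 m_gt0.
  have c0 : pizzetti_coef R m N != 0 by rewrite gt_eqF // pizzetti_coef_gt0.
  by rewrite (_ : _ + _ = 0) // ; field; rewrite A0 c0.
move: (_%:P) (_%:P) hA => c c' hA.
apply/eqP; rewrite -subr_eq0; apply/eqP.
transitivity ((c' * A%:R + c) * (w ^+ N * g)); last by rewrite hA mul0r.
rewrite /A; move: (w ^+ N) => W.
rewrite !(natrD, natrM) -natr1; ring.
Qed.

Lemma derivn_Xn_eq0 k n : (k < n)%N -> ('X^k)^`(n) = 0 :> {poly R}.
Proof. by move=> kn; rewrite derivnXn ffact_small // mulr0n. Qed.

Lemma zonal_truncE k N : (k < N)%N -> zonal_trunc k N = zonal k.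
Proof.
move=> kN; rewrite -(subnKC kN); elim: (N - _)%N => [|i IH]; first by rewrite addn0.
rewrite addnS zonal_truncS IH.
rewrite derivn_Xn_eq0 ?mulr0 ?addr0 //.
by rewrite mul2n -addnn !addSn ltnS -addnA leq_addr.
Qed.

Lemma legendre_op_zonal k :
  legendre_op (zonal k) + k%:R * (k%:R + m%:R - 1) * zonal k = 0.
Proof.
rewrite legendre_op_zonal_trunc derivn_Xn_eq0 ?mulr0 //.
by rewrite mul2n -addnn addSn ltnS leq_addr.
Qed.

Lemma zonal1 k : (zonal k).[1] = 1.
Proof.
rewrite /zonal /zonal_trunc big_ord_recl hornerD horner_sum big1 => [|j _].
  rewrite addr0 muln0 derivn0 !expr0 /pizzetti_coef big_ord0 divr1 !mul1r.
  by rewrite hornerXn expr1n.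
have w1 : w.[1] = 0 by rewrite !hornerE subrr.
by rewrite hornerM [X in _ * X]hornerM horner_exp w1 lift0 expr0n mul0r mulr0.
Qed.

(** Let [c] be the maximum of [v / y], attained at [s]. Then [q = c y - v] has minimum 0 at [s],
    where the equation makes [legendre_op q] negative, while minimality makes it nonnegative. *)
Lemma legendre_max_principle (y v : {poly R}) (mu a : R) :
    -1 <= a < 1 -> legendre_op y + mu%:P * y = 0 ->
    (forall x, a <= x <= 1 -> 0 < y.[x]) ->
    0 < v.[1] -> v.[a] <= 0 \/ a = -1 ->
    (forall x, a <= x <= 1 -> 0 < (legendre_op v + mu%:P * v).[x]) ->
  False.
Proof.
move=> /andP[aN1 a1] ode ypos v1 va Lv.
have cont : {within `[a, 1], continuous (fun x => v.[x] / y.[x])}.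
  apply: continuous_in_subspaceT => x; rewrite inE /= in_itv /= => hx.
  apply: cvgM; first exact: continuous_horner.
  apply: cvgV; last exact: continuous_horner.
  by rewrite gt_eqF // ypos.
have [s] := EVT_max (ltW a1) cont; rewrite in_itv /= => hs smax.
set c := v.[s] / y.[s] in smax.
pose q := c%:P * y - v.
have qs : q.[s] = 0.
  by rewrite /q !hornerE /c divfK ?subrr // gt_eqF // ypos.
have qge x : a <= x <= 1 -> q.[s] <= q.[x].
  move=> hx; rewrite qs /q !hornerE subr_ge0 -ler_pdivrMr ?ypos //.
  by apply: smax; rewrite in_itv.
have Lq : legendre_op q + mu%:P * q = - (legendre_op v + mu%:P * v).
  have -> : q = c%:P * y + (-1)%:P * v by rewrite /q polyCN polyC1 mulN1r.
  rewrite legendre_opD !legendre_opCM polyCN polyC1.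
  transitivity (c%:P * (legendre_op y + mu%:P * y) - (legendre_op v + mu%:P * v)).
    by ring.
  by rewrite ode mulr0 sub0r.
have := Lv s hs; rewrite -oppr_lt0 -hornerN -Lq ltNge => /negP; apply.
pose r := q \Po ('X + s%:P).
have rE x : r.[x] = q.[x + s] by rewrite /r horner_comp !hornerE.
have dr (p : {poly R}) : (p \Po ('X + s%:P))^`() = p^`() \Po ('X + s%:P).
  by rewrite deriv_comp derivD derivX derivC addr0 mulr1.
have r'E : r^`().[0] = q^`().[s] by rewrite /r dr horner_comp !hornerE.
have r''E : r^`()^`().[0] = q^`()^`().[s] by rewrite /r !dr horner_comp !hornerE.
rewrite hornerD hornerM qs mulr0 addr0 /legendre_op -polyC_natr !hornerE /=.
case/andP: (hs) => sa s1.
(* At [s = 1] the second-order coefficient degenerates and [- m q'(1)] remains, so the one-sided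
   sign of the derivative is enough; [s = -1] is symmetric. *)
have [s1'|s1'] := eqVneq s 1.
  have : q^`().[s] <= 0.
    rewrite -r'E; apply: (@deriv_le0_min_left _ _ (1 - a)); rewrite ?subr_gt0 // => t ht.
    rewrite !rE add0r; apply: qge; lra.
  rewrite s1' !mulr1 subrr mul0r sub0r oppr_ge0 => h.
  by rewrite mulr_ge0_le0.
have [sa'|sa'] := eqVneq s a.
  (* If [v(a) <= 0], the maximum cannot be at [a], because the quotient is positive at 1. *)
  case: va => [va|aN].
    have c0 : c <= 0 by rewrite /c sa' pmulr_lle0 // invr_gt0 ypos // lexx ltW.
    have := smax 1; rewrite in_itv /= lexx ltW // => /(_ isT).
    have : 0 < v.[1] / y.[1] by rewrite divr_gt0 // ypos // lexx ltW.
    lra.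
  have : 0 <= q^`().[s].
    rewrite -r'E; apply: (@deriv_ge0_min_right _ _ (1 - a)); rewrite ?subr_gt0 // => t ht.
    rewrite !rE add0r; apply: qge; lra.
  rewrite sa' aN mulrNN !mulr1 subrr mul0r sub0r mulrN1 mulNr opprK => h.
  by rewrite mulr_ge0.
have s_lt1 : s < 1 by rewrite lt_neqAle s1' s1.
have a_lts : a < s by rewrite lt_neqAle eq_sym sa' sa.
have := @deriv_min _ r (Num.min (1 - s) (s - a)).
rewrite lt_min !subr_gt0 s_lt1 a_lts => /(_ isT)[t|].
  rewrite lt_min !rE add0r => /andP[]; rewrite !ltr_norml => h1 h2.
  by apply: qge; lra.
rewrite r'E r''E => -> q2; rewrite !mulr0 subr0 mulr_ge0 //.
by rewrite subr_ge0; nra.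
Qed.

End ZonalPolynomial.

(** * Locating a root of the Gegenbauer polynomial *)

Lemma acos_le_of_cos_le (R : realType) (x t : R) : -1 <= x <= 1 ->
  0 <= t <= pi -> cos t <= x -> acos x <= t.
Proof.
move=> hx ht tx; rewrite leNgt; apply/negP => lt_t.
have := @ltr_cos R t (acos x); rewrite !in_itv /= acos_ge0 // acos_lepi // ht.
by move=> /(_ isT isT); rewrite acosK ?in_itv // lt_t => h; move: tx; rewrite leNgt h.
Qed.

(** The mean value theorem gives [sin t = t cos c] with [2 c <= 1 <= pi / 2]. Hence
    [cos (2 c) >= 0], that is [cos c ^ 2 >= 1/2], and [cos (2 t) = 1 - 2 sin t ^ 2] is bounded. *)
Lemma cos_mulr2n_le (R : realType) (t : R) : 0 <= t <= 1 / 2 ->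
  cos (t *+ 2) <= 1 - t ^+ 2.
Proof.
move=> /andP[t0 t2]; have := cos2Dsin2 t.
have [|c] := @MVT_segment R sin cos 0 t t0 _ _.
- by apply: continuous_subspaceT; exact: continuous_sin.
rewrite in_itv /= => /andP[c0 ct].
rewrite sin0 !subr0 => ->; rewrite exprMn => e.
have c2 : 1 / 2 <= cos c ^+ 2.
  have := @cos_ge0_pihalf R (c *+ 2); rewrite cos_mulr2n.
  have := pihalf_ge1 R; rewrite -(mulr_natl c) -(mulr_natl (cos c ^+ 2)) => hp h.
  have : 0 <= 2 * cos c ^+ 2 - 1 by apply: h; lra.
  lra.
rewrite cos_mulr2n -mulr_natl.
have : 1 / 2 * t ^+ 2 <= cos c ^+ 2 * t ^+ 2 by rewrite ler_wpM2r // sqr_ge0.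
lra.
Qed.

(** By the maximum principle a test function [v] prevents the zonal polynomial from being positive
    on all of [[a, 1]]; as its value at 1 is 1, it has a root there. *)
Lemma zonal_root_ge (R : realType) (m k : nat) (v : {poly R}) (a : R) :
    (0 < m)%N -> -1 <= a < 1 -> 0 < v.[1] -> v.[a] <= 0 \/ a = -1 ->
    (forall x, a <= x <= 1 ->
      0 < (legendre_op m v + (k%:R * (k%:R + m%:R - 1))%:P * v).[x]) ->
  exists2 x, a <= x <= 1 & (zonal R m k).[x] = 0.
Proof.
move=> m0 ha v1 va Lv.
have [h|] := pselect (forall x, a <= x <= 1 -> 0 < (zonal R m k).[x]).
  exfalso; apply: (legendre_max_principle ha _ h v1 va Lv).
  rewrite -[RHS](legendre_op_zonal R m0 k); congr (_ + _ * _).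
  by rewrite polyCM !polyCD polyCN !polyC_natr.
move=> /existsNP [x /not_implyP [/andP[ax x1] /negP]]; rewrite -leNgt => yx.
have [|z /andP[xz z1] /eqP rz] := @poly_ivt R (zonal R m k) x 1 x1.
  by rewrite yx zonal1 ler01.
by exists z => //; rewrite z1 (le_trans ax).
Qed.

Lemma zonal_root (R : realType) (m k : nat) : (0 < m)%N -> (0 < k)%N ->
  exists x : R, [/\ -1 <= x <= 1, (zonal R m k).[x] = 0 &
    acos x <= pi ^+ 2 * m.+1%:R * k%:R^-1].
Proof.
move=> m0 k0; have kR : 0 < k%:R :> R by rewrite ltr0n.
have mR : 0 < m%:R :> R by rewrite ltr0n.
have k1 : 1 <= k%:R :> R by rewrite ler1n.
have m1 : 1 <= m%:R :> R by rewrite ler1n.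
have mu0 : 0 < k%:R * (k%:R + m%:R - 1) :> R by rewrite mulr_gt0 //; lra.
set eta : R := m.+1%:R * k%:R^-1.
have eta0 : 0 < eta by rewrite mulr_gt0 ?invr_gt0 ?ltr0n.
rewrite -mulrA -/eta.
have pi2 := pi_ge2 R.
(* When [pi * eta >= 1] the bound is at least [pi], so any root in [[-1, 1]] will do and the
   constant 1 is a test function. *)
have [big|small] := leP 1 (pi * eta).
  have [|||x _|x hx yx] := @zonal_root_ge R m k 1 (-1) m0.
  - by rewrite lexx /=; lra.
  - by rewrite hornerC.
  - by right.
  - by rewrite /legendre_op derivC !derivC !mulr0 subrr add0r mulr1 hornerC.
  exists x; split=> //; apply: le_trans (acos_lepi hx) _.
  by rewrite expr2 -mulrA ler_peMr // pi_ge0.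
have eta2 : eta < 1 / 2 by nra.
pose a := 1 - eta ^+ 2.
have a_ge : 3 / 4 <= a by rewrite /a; nra.
have a_lt1 : a < 1 by rewrite /a; nra.
have ke : k%:R * eta = m%:R + 1.
  by rewrite /eta mulrCA divff ?gt_eqF // mulr1 natr1.
have [|||x /andP[ax x1]|x /andP[ax x1] yx] :=
    @zonal_root_ge R m k (('X - a%:P) * ('X - a%:P)) a m0.
- by rewrite a_lt1 andbT; lra.
- by rewrite hornerM hornerXsubC mulr_gt0 // subr_gt0.
- by left; rewrite hornerM hornerXsubC subrr mul0r.
- have -> : (legendre_op m (('X - a%:P) * ('X - a%:P)) +
      (k%:R * (k%:R + m%:R - 1))%:P * (('X - a%:P) * ('X - a%:P))).[x] =
      2 * (1 - x ^+ 2) - 2 * m%:R * x * (x - a)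
      + k%:R * (k%:R + m%:R - 1) * (x - a) ^+ 2.
    rewrite /legendre_op !(derivM, derivD, derivN, derivX, derivC) -polyC_natr.
    rewrite !hornerE /=.
    ring.
  (* Since [k eta = m + 1] and [1 - a = eta^2], the expression equals [eta^2 + (k (x - a) - eta)^2 +
     2 x (1 - x) + 2 m (1 - x) (x - a) + k (m - 1) (x - a)^2]; the choice of [eta] is made to
     complete this square. *)
  have h0 : 0 <= x - a by rewrite subr_ge0.
  have p1 : 0 <= (1 - x) * x by apply: mulr_ge0; lra.
  have p2 : 0 <= m%:R * (1 - x) * (x - a).
    by rewrite !mulr_ge0 //; lra.
  have p3 : 0 <= k%:R * (m%:R - 1) * (x - a) ^+ 2.
    by rewrite !mulr_ge0 ?sqr_ge0 //; lra.
  have p4 : 0 <= (k%:R * (x - a) - eta) ^+ 2 by apply: sqr_ge0.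
  have p5 : 0 < eta ^+ 2 by rewrite exprn_gt0.
  have e1 : k%:R * (x - a) * eta = (m%:R + 1) * (x - a) by rewrite -ke; ring.
  have ea : eta ^+ 2 = 1 - a by rewrite /a; ring.
  move: p4; rewrite sqrrB e1 => p4.
  nra.
exists x; split=> //; first by rewrite x1 andbT; lra.
(* From [cos (2 eta) <= 1 - eta^2 = a <= x] the angle is at most [2 eta], and [2 <= pi^2]. *)
apply: (@le_trans _ _ (eta *+ 2)).
  apply: acos_le_of_cos_le; [by rewrite x1 andbT; lra|by rewrite -mulr_natl; lra|].
  by apply: le_trans (cos_mulr2n_le _) ax; rewrite (ltW eta0) ltW.
by rewrite -mulr_natl ler_pM2r //; nra.
Qed.

(** * Means over geodesic spheres *)

Section Dotprod.
Variables (R : realType) (n : nat).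
Implicit Types (x y z : 'rV[R]_n) (a : R).

Lemma dotprodC x y : dotprod x y = dotprod y x.
Proof. by apply: eq_bigr => i _; rewrite mulrC. Qed.

Lemma dotprodDr x y z : dotprod x (y + z) = dotprod x y + dotprod x z.
Proof. by rewrite -big_split; apply: eq_bigr => i _ /=; rewrite mxE mulrDr. Qed.

Lemma dotprodDl x y z : dotprod (x + y) z = dotprod x z + dotprod y z.
Proof. by rewrite dotprodC dotprodDr !(dotprodC z). Qed.

Lemma dotprodZr a x y : dotprod x (a *: y) = a * dotprod x y.
Proof. by rewrite /dotprod mulr_sumr; apply: eq_bigr => i _; rewrite mxE mulrCA. Qed.

Lemma dotprodZl a x y : dotprod (a *: x) y = a * dotprod x y.
Proof. by rewrite dotprodC dotprodZr dotprodC. Qed.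

Lemma dotprodBr x y z : dotprod x (y - z) = dotprod x y - dotprod x z.
Proof. by rewrite dotprodDr -scaleN1r dotprodZr mulN1r. Qed.

Lemma dotprodBl x y z : dotprod (x - y) z = dotprod x z - dotprod y z.
Proof. by rewrite dotprodC dotprodBr !(dotprodC z). Qed.

Lemma dotprod_sumr (I : finType) x (F : I -> 'rV[R]_n) :
  dotprod x (\sum_i F i) = \sum_i dotprod x (F i).
Proof.
rewrite /dotprod exchange_big; apply: eq_bigr => i _ /=.
by rewrite summxE mulr_sumr.
Qed.

Lemma dotprod_delta x i : dotprod x (delta_mx 0 i) = x 0 i.
Proof.
rewrite /dotprod (bigD1 i) //= mxE !eqxx mulr1 big1 ?addr0 // => j /negbTE ji.
by rewrite mxE ji andbF mulr0.
Qed.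

End Dotprod.

Section Frame.
Variables (R : realType) (m : nat).
Implicit Types (z : 'rV[R]_m.+1).

(* The Householder reflection exchanging the first basis vector and z; when
   they coincide, the division by zero makes it the identity. *)
Lemma householder z : unit_sphere z ->
  exists U : 'M[R]_m.+1, [/\ U *m U^T = 1%:M, U^T *m U = 1%:M & row 0 U = z].
Proof.
move=> hz; pose v := z - delta_mx 0 0.
pose s := dotprod v v.
have vvT : v *m v^T = s%:M.
  apply/matrixP => i j; rewrite !ord1 !mxE eqxx mulr1n.
  by apply: eq_bigr => l _; rewrite !mxE.
have sE : s = 2 - 2 * z 0 0.
  rewrite /s /v dotprodBl !dotprodBr [dotprod (delta_mx _ _) z]dotprodC.
  rewrite (hz : dotprod z z = 1) !dotprod_delta mxE !eqxx /=; ring.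
pose U : 'M[R]_m.+1 := 1%:M - (2 / s) *: (v^T *m v).
have UT : U^T = U by rewrite /U linearB linearZ /= trmx1 trmx_mul trmxK.
have VV : (v^T *m v) *m (v^T *m v) = s *: (v^T *m v).
  by rewrite mulmxA -(mulmxA v^T) vvT mul_mx_scalar -scalemxAl.
have UU : U *m U = 1%:M.
  rewrite /U mulmxBr mulmx1 mulmxBl mul1mx -scalemxAl -scalemxAr VV !scalerA.
  rewrite opprB addrA -addrA -scaleNr -!scalerDl.
  rewrite -addrA -scalerDl.
  suff -> : - (2 / s) + (2 / s * (2 / s) * s - 2 / s) = 0 by rewrite scale0r addr0.
  by have [->|s0] := eqVneq s 0; [rewrite invr0; ring|field].
exists U; rewrite UT; split=> //.
apply/rowP => j; rewrite !mxE big_ord1 !mxE eqxx /=.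
have [s0|s0] := eqVneq s 0.
  have v0 : v 0 j = 0.
    apply/eqP; rewrite -sqrf_eq0 eq_le sqr_ge0 andbT -s0.
    exact: sqr_coord_le_dotprod.
  rewrite s0 invr0 mulr0 mul0r subr0.
  by move: v0; rewrite /v !mxE eqxx /= eq_sym => /eqP; rewrite subr_eq0 => /eqP ->.
rewrite sE in s0 *; rewrite [j == _]eq_sym; field.
by [].
Qed.

(** The vectors are the other rows of an orthogonal matrix with first row [z]. The third property,
    the projection onto the complement of [z], serves to compute the Laplacian in a hyperplane. *)
Lemma orthonormal_complement z : unit_sphere z ->
  exists B : 'I_m -> 'rV[R]_m.+1,
  [/\ forall j j', dotprod (B j) (B j') = (j == j')%:R,
      forall j, dotprod z (B j) = 0 &
      forall i i', \sum_j B j 0 i * B j 0 i' = (i == i')%:R - z 0 i * z 0 i'].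
Proof.
move=> /householder [U [UUT UTU U0]].
exists (fun j => row (lift ord0 j) U); split=> [j j'|j|i i'].
- have := congr1 (fun M : 'M[R]_m.+1 => M (lift ord0 j) (lift ord0 j')) UUT.
  rewrite !mxE (inj_eq lift_inj) => <-.
  by apply: eq_bigr => i _; rewrite !mxE.
- have := congr1 (fun M : 'M[R]_m.+1 => M 0 (lift ord0 j)) UUT.
  rewrite !mxE eq_liftF => e; rewrite -[RHS]e.
  by apply: eq_bigr => i _; rewrite -U0 !mxE.
have := congr1 (fun M : 'M[R]_m.+1 => M i i') UTU.
rewrite !mxE => <-; rewrite big_ord_recl -U0 !mxE addrAC subrr add0r.
by apply: eq_bigr => j _; rewrite !mxE.
Qed.

End Frame.

Lemma meval_mmap (R : comNzRingType) (n k : nat) (h : 'I_n -> {mpoly R[k]})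
    (p : {mpoly R[n]}) (v : 'I_k -> R) :
  (mmap (@mpolyC k R) h p).@[v] = p.@[fun i => (h i).@[v]].
Proof.
rewrite [in RHS]mevalE /mmap raddf_sum; apply: eq_bigr => u _ /=.
rewrite mevalM mevalC /mmap1 rmorph_prod; congr (_ * _).
by apply: eq_bigr => i _; rewrite rmorphXn.
Qed.

Section DirectionalDerivative.
Variables (R : realType) (n : nat) (z : 'rV[R]_n).
Implicit Types (f : {mpoly R[n]}).

Definition dirderiv f : {mpoly R[n]} := \sum_i z 0 i *: f^`M(i).

Lemma laplacian_dirderiv f : laplacian (dirderiv f) = dirderiv (laplacian f).
Proof.
rewrite /dirderiv linear_sum; apply: eq_bigr => i _ /=.
rewrite linearZ /=; congr (_ *: _); rewrite /laplacian linear_sum.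
by apply: eq_bigr => j _ /=; rewrite [RHS]mderiv_comm [f^`M(j)^`M(i)]mderiv_comm.
Qed.

Lemma dirderiv0 : dirderiv 0 = 0.
Proof. by rewrite /dirderiv big1 // => i _; rewrite linear0 scaler0. Qed.

Definition radial f : {poly R} := mmap (@polyC R) (fun i => (z 0 i)%:P * 'X) f.

Lemma horner_radial f c : (radial f).[c] = evalv f (c *: z).
Proof.
rewrite /radial horner_mmap; apply: meval_eq => i.
by rewrite mxE !hornerE mulrC.
Qed.

(** This is the source of the derivatives of ['X^k] in [zonal_trunc]: on the axis of [z],
    directional derivatives are ordinary derivatives of [f(z) X^k] when [f] is homogeneous of degree
    [k]. *)
Lemma derivn_radial j f : (radial f)^`(j) = radial (iter j dirderiv f).
Proof.
elim: j => // j IH; rewrite derivnS IH iterS; set g := iter j _ f.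
rewrite /radial deriv_mmap [dirderiv g in RHS]/dirderiv raddf_sum.
apply: eq_bigr => i _ /=.
by rewrite mul_polyC derivZ derivX mmapZ mulrC -mul_polyC mulr1.
Qed.

Lemma radial_homog k f : f \is k.-homog -> radial f = (evalv f z)%:P * 'X^k.
Proof.
move=> /dhomogP hf; rewrite /radial /evalv mevalE /mmap rmorph_sum mulr_suml.
rewrite big_seq [RHS]big_seq; apply: eq_bigr => u hu.
rewrite rmorphM -mulrA; congr (_ * _).
rewrite rmorph_prod -(hf _ hu) /= mdegE -prodrXr -big_split /=.
by apply: eq_bigr => i _; rewrite exprMn rmorphXn.
Qed.

End DirectionalDerivative.

Section SphericalMean.
Variables (R : realType) (m : nat) (z : 'rV[R]_m.+1) (B : 'I_m -> 'rV[R]_m.+1).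
Variables (c s : R).
Hypothesis z_unit : unit_sphere z.
Hypothesis B_orth : forall j j', dotprod (B j) (B j') = (j == j')%:R.
Hypothesis zB : forall j, dotprod z (B j) = 0.
Hypothesis BB : forall i i',
  \sum_j B j 0 i * B j 0 i' = (i == i')%:R - z 0 i * z 0 i'.
Hypothesis cs1 : c ^+ 2 + s ^+ 2 = 1.
Implicit Types (f : {mpoly R[m.+1]}).

Definition slice_coord (i : 'I_m.+1) : {mpoly R[m]} :=
  (c * z 0 i)%:MP + \sum_j (s * B j 0 i)%:MP * 'X_j.

(* f in the coordinates w of the hyperplane through c z orthogonal to z:
   w stands for the point c z + s \sum_j w_j B_j. *)
Definition slice f : {mpoly R[m]} := mmap (@mpolyC m R) slice_coord f.

Lemma mderiv_slice j f :
  (slice f)^`M(j) = \sum_i slice f^`M(i) * (s * B j 0 i)%:MP.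
Proof.
rewrite /slice (@mmap_chain_rule R {mpoly R[m]} _ (@mpolyC m R) slice_coord (mderiv j)).
- apply: eq_bigr => i _; congr (_ * _).
  rewrite /slice_coord /= mderivD mderivC add0r raddf_sum (bigD1 j) //=.
  rewrite mderiv_mulC mderivX1 eqxx mulr1 big1 ?addr0 // => l lj.
  by rewrite mderiv_mulC mderivX1 (negbTE lj) mulr0.
- exact: mderivM.
- by move=> x; exact: mderivC.
Qed.

(** By [BB], summing second derivatives over the frame gives the full Laplacian minus its part along
    [z]; the chain rule contributes [s^2]. *)
Lemma laplacian_slice f :
  laplacian (slice f) =
  (s ^+ 2) *: (slice (laplacian f) - slice (dirderiv z (dirderiv z f))).
Proof.
pose D i i' := slice f^`M(i)^`M(i').
have -> : laplacian (slice f) = \sum_i \sum_i' D i i' *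
    (s ^+ 2 * \sum_j B j 0 i * B j 0 i')%:MP.
  rewrite /laplacian.
  under eq_bigr => j _.
    rewrite mderiv_slice linear_sum /=.
    under eq_bigr => i _ do rewrite mulrC mderiv_mulC mderiv_slice mulr_sumr.
    over.
  rewrite exchange_big /=; apply: eq_bigr => i _.
  rewrite exchange_big /=; apply: eq_bigr => i' _.
  rewrite mulr_sumr rmorph_sum mulr_sumr; apply: eq_bigr => j _ /=.
  by rewrite !rmorphM ?rmorphXn /= /D; ring.
have -> : slice (laplacian f) = \sum_i \sum_i' D i i' * ((i == i')%:R)%:MP.
  rewrite /slice /laplacian raddf_sum; apply: eq_bigr => i _ /=.
  rewrite (bigD1 i) //= eqxx mulr1 big1 ?addr0 // => i' /negbTE.
  by rewrite eq_sym => ->; rewrite mulr0.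
have -> : slice (dirderiv z (dirderiv z f)) =
    \sum_i \sum_i' D i i' * (z 0 i * z 0 i')%:MP.
  rewrite /dirderiv /slice raddf_sum exchange_big /=; apply: eq_bigr => i _.
  rewrite mmapZ linear_sum raddf_sum mulr_sumr; apply: eq_bigr => i' _ /=.
  by rewrite linearZ mmapZ rmorphM /D /slice /=; ring.
rewrite -sumrB scaler_sumr; apply: eq_bigr => i _.
rewrite -sumrB scaler_sumr; apply: eq_bigr => i' _.
rewrite BB -mul_mpolyC rmorphM rmorphB /=; ring.
Qed.

(** Differentiation along [z] preserves harmonicity, so only the [z] part survives at every
    iteration. *)
Lemma iter_laplacian_slice j f : laplacian f = 0 ->
  iter j (@laplacian R m) (slice f) =
  ((- (s ^+ 2)) ^+ j) *: slice (iter (2 * j) (dirderiv z) f).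
Proof.
elim: j f => [|j IH] f hf; first by rewrite muln0 expr0 scale1r.
have hd g : laplacian g = 0 -> laplacian (dirderiv z g) = 0.
  by move=> hg; rewrite laplacian_dirderiv hg dirderiv0.
rewrite iterSr [(2 * j.+1)%N]mulnS [(2 + _)%N]addnC iterD.
rewrite laplacian_slice hf [slice 0]raddf0 sub0r scalerN -scaleNr.
rewrite linearZ /= IH; last exact: (hd _ (hd _ hf)).
by rewrite scalerA -exprS.
Qed.

Lemma meval_slice f (w : 'I_m -> R) :
  (slice f).@[w] = evalv f (c *: z + \sum_j (s * w j) *: B j).
Proof.
rewrite /slice meval_mmap; apply: meval_eq => i.
rewrite /slice_coord mevalD mevalC !mxE summxE raddf_sum; congr (_ + _).
by apply: eq_bigr => j _ /=; rewrite mevalM mevalC mevalXU !mxE mulrAC.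
Qed.

(** The origin of the slice is the point [c z], where the iterated [z] derivatives of [f] are
    derivatives of [f(z) X^k] at [c]; with [s^2 = 1 - c^2] the sums agree term by term. *)
Lemma pizzetti_slice N k f : (k < N)%N -> harmonic_polys R m.+1 k f ->
  pizzetti N (slice f) = (zonal R m k).[c] * evalv f z.
Proof.
move=> kN [fk hf]; rewrite -(zonal_truncE _ _ kN) /zonal_trunc horner_sum mulr_suml.
rewrite /pizzetti; apply: eq_bigr => j _.
rewrite iter_laplacian_slice // mevalZ meval_slice.
under eq_bigr => i _ do rewrite mulr0 scale0r.
rewrite big1 // addr0 -horner_radial -derivn_radial (radial_homog z fk).
rewrite mul_polyC derivnZ hornerZ !hornerM hornerC horner_exp.
have -> : (1 - 'X * 'X).[c] = s ^+ 2.
  by rewrite !hornerE -expr2 -cs1; ring.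
rewrite [(- _ ^+ 2) ^+ j]exprNn; move: (s ^+ 2 ^+ j) ((-1) ^+ j) => S e; ring.
Qed.

Lemma slice_point (w : 'I_m -> R) : \sum_j w j * w j = 1 ->
  let u := c *: z + \sum_j (s * w j) *: B j in
  unit_sphere u /\ dotprod z u = c.
Proof.
move=> w1 u; pose b := \sum_j (s * w j) *: B j.
have zb : dotprod z b = 0.
  by rewrite dotprod_sumr big1 // => j _; rewrite dotprodZr zB mulr0.
have bb : dotprod b b = s ^+ 2.
  rewrite {2}/b dotprod_sumr -[RHS]mulr1 -w1 mulr_sumr; apply: eq_bigr => j _.
  rewrite dotprodZr dotprodC /b dotprod_sumr (bigD1 j) //= dotprodZr B_orth eqxx.
  rewrite big1 => [|l lj]; last by rewrite dotprodZr B_orth eq_sym (negbTE lj) mulr0.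
  by rewrite /=; ring.
have zz : dotprod z z = 1 by exact: z_unit.
rewrite /u -/b; split; last by rewrite dotprodDr dotprodZr zb zz mulr1 addr0.
rewrite /unit_sphere /= !dotprodDl !dotprodDr !dotprodZl !dotprodZr.
by rewrite (dotprodC b) zz zb bb -[RHS]cs1; ring.
Qed.

End SphericalMean.

(* The mean over the geodesic sphere of radius acos c around z multiplies a
   degree k harmonic polynomial by y_k(c), and it preserves positivity. *)
Lemma zonal_mean_gt0 (R : realType) (m : nat) (l : seq nat) (a : nat -> R)
    (f : nat -> {mpoly R[m.+1]}) (z : 'rV[R]_m.+1) (c : R) :
    (0 < m)%N -> unit_sphere z -> -1 <= c <= 1 ->
    (forall k, k \in l -> harmonic_polys R m.+1 k (f k)) ->
    (forall u, unit_sphere u -> dotprod z u = c ->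
      0 < \sum_(k <- l) a k * evalv (f k) u) ->
  0 < \sum_(k <- l) a k * (zonal R m k).[c] * evalv (f k) z.
Proof.
move=> m0 z1 c1 hf hpos.
have [B [BO zB BB]] := orthonormal_complement z1.
pose s := Num.sqrt (1 - c ^+ 2).
have cs1 : c ^+ 2 + s ^+ 2 = 1.
  by rewrite sqr_sqrtr; [ring|nra].
pose g := \sum_(k <- l) a k *: slice z B c s (f k).
have [|N0 hN0] := @pizzetti_gt0 R m g m0.
  move=> w w1; have [u1 uc] := slice_point z1 BO zB cs1 w1.
  rewrite /evalv /g raddf_sum /=.
  under eq_bigr => k _ do rewrite mevalZ meval_slice.
  exact: hpos.
(* One cut-off must serve both positivity and the closed formula for every degree in [l]. *)
have [N [NN0 Nl]] : exists N, (N0 <= N)%N /\ forall k, k \in l -> (k < N)%N.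
  exists (maxn N0 (\max_(k <- l) k).+1); rewrite leq_maxl; split=> // k kl.
  by rewrite leq_max ltnS orbC (leq_bigmax_seq (F := id)).
have := hN0 N NN0; rewrite /g raddf_sum /=.
rewrite big_seq [X in _ -> 0 < X]big_seq.
under eq_bigr => k kl.
  rewrite linearZ /= (pizzetti_slice BB cs1 (Nl k kl) (hf k kl)) mulrA; over.
by [].
Qed.

(** * Geometry of the sphere *)

Section SphereGeometry.
Variables (R : realType) (n : nat).
Implicit Types (x y z u : 'rV[R]_n).

Lemma dotprod_eq0 x : dotprod x x = 0 -> x = 0.
Proof.
move=> x0; apply/rowP => i; rewrite mxE; apply/eqP.
by rewrite -sqrf_eq0 eq_le sqr_ge0 andbT -x0 sqr_coord_le_dotprod.
Qed.

Lemma cauchy_schwarz_dotprod x y :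
  dotprod x y ^+ 2 <= dotprod x x * dotprod y y.
Proof.
have [/dotprod_eq0 ->|y0] := eqVneq (dotprod y y) 0.
  by rewrite -(scale0r 0) !dotprodZr !mul0r mulr0 expr0n.
have yy : 0 < dotprod y y by rewrite lt0r y0 dotprod_ge0.
have := dotprod_ge0 (dotprod y y *: x - dotprod x y *: y).
rewrite dotprodBl !dotprodBr !dotprodZl !dotprodZr (dotprodC y x).
set A := dotprod x x; set B := dotprod y y in yy *; set C := dotprod x y => h.
rewrite -subr_ge0 -(pmulr_rge0 _ yy).
by apply: le_trans h _; rewrite le_eqVlt; apply/orP; left; apply/eqP; ring.
Qed.

Lemma dotprod_itv x y : unit_sphere x -> unit_sphere y -> -1 <= dotprod x y <= 1.
Proof.
move=> hx hy; have := cauchy_schwarz_dotprod x y.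
rewrite (hx : dotprod x x = 1) (hy : dotprod y y = 1) mulr1 => h.
by rewrite -ler_norml -(@expr_le1 _ 2) // real_normK // num_real.
Qed.

(** After taking cosines, this is Cauchy-Schwarz for the components of [x] and [u] orthogonal to
    [z]. If the sum of the two distances reaches [pi], nothing remains to be shown. *)
Lemma geodesic_dist_triangle x z u :
  unit_sphere x -> unit_sphere z -> unit_sphere u ->
  geodesic_dist x u <= geodesic_dist x z + geodesic_dist z u.
Proof.
move=> hx hz hu; rewrite /geodesic_dist.
have xz := dotprod_itv hx hz; have zu := dotprod_itv hz hu.
have xu := dotprod_itv hx hu.
have [big|small] := leP pi (acos (dotprod x z) + acos (dotprod z u)).
  exact: le_trans (acos_lepi xu) big.
apply: acos_le_of_cos_le => //; first by rewrite addr_ge0 ?acos_ge0 // ltW.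
rewrite cosD !sin_acos // !acosK ?in_itv //.
set a := dotprod x z in xz *; set b := dotprod z u in zu *.
have a1 : 0 <= 1 - a ^+ 2 by nra.
have b1 : 0 <= 1 - b ^+ 2 by nra.
have := cauchy_schwarz_dotprod (x - a *: z) (u - b *: z).
rewrite !dotprodBl !dotprodBr !dotprodZl !dotprodZr (dotprodC z x) (dotprodC u z) -/a -/b.
rewrite (hx : dotprod x x = 1) (hz : dotprod z z = 1) (hu : dotprod u u = 1).
have -> : dotprod x u - b * a - (a * b - a * (b * 1)) = dotprod x u - a * b by ring.
have -> : 1 - a * a - (a * a - a * (a * 1)) = 1 - a ^+ 2 by ring.
have -> : 1 - b * b - (b * b - b * (b * 1)) = 1 - b ^+ 2 by ring.
move=> h; rewrite -sqrtrM // lerBlDr -lerBlDl.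
apply: le_trans (ler_norm _) _; rewrite -normrN opprB -sqrtr_sqr.
by rewrite ler_wsqrtr.
Qed.

End SphereGeometry.

Section GreatCircle.
Variables (R : realType) (m : nat).
Implicit Types (x z w : 'rV[R]_m.+1).

Lemma great_circle x z : (0 < m)%N -> unit_sphere x -> unit_sphere z ->
  exists w, [/\ unit_sphere w, dotprod x w = 0 &
    z = cos (geodesic_dist x z) *: x + sin (geodesic_dist x z) *: w].
Proof.
move=> m0 hx hz; have xz := dotprod_itv hx hz.
rewrite /geodesic_dist acosK ?in_itv // sin_acos //.
set c := dotprod x z in xz *.
have xx : dotprod x x = 1 by []; have zz : dotprod z z = 1 by [].
have c1 : 0 <= 1 - c ^+ 2 by nra.
have zc : dotprod (z - c *: x) (z - c *: x) = 1 - c ^+ 2.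
  rewrite dotprodBl !dotprodBr !dotprodZl !dotprodZr (dotprodC z x) xx zz -/c; ring.
set s := Num.sqrt (1 - c ^+ 2).
have s2 : s ^+ 2 = 1 - c ^+ 2 by rewrite sqr_sqrtr.
(* If [z] is [x] or its antipode, the direction is undetermined: any unit vector orthogonal to [x]
   works, and one exists because [m > 0]. *)
have [s0|s0] := eqVneq s 0.
  have [B [BO xB _]] := orthonormal_complement hx.
  exists (B (Ordinal m0)); split; [by rewrite /unit_sphere /= BO eqxx|exact: xB|].
  rewrite s0 scale0r addr0; apply/eqP; rewrite -subr_eq0; apply/eqP.
  by apply: dotprod_eq0; rewrite zc -s2 s0 expr0n.
exists (s^-1 *: (z - c *: x)); split.
- by rewrite /unit_sphere /= dotprodZl dotprodZr zc -s2 expr2 mulKf // mulVf.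
- by rewrite dotprodZr dotprodBr dotprodZr xx mulr1 -/c subrr mulr0.
by rewrite scalerA divff // scale1r addrC subrK.
Qed.

(** The intermediate value theorem is applied along the great-circle arc from [x] to [z]; its point
    at parameter [v] is at distance [v] from [x], hence inside the ball. *)
Lemma same_sign_on_ball (p : {mpoly R[m.+1]}) x (r : R) : (0 < m)%N ->
    unit_sphere x -> (forall z, geodesic_ball x r z -> evalv p z != 0) ->
  forall z, geodesic_ball x r z -> 0 < evalv p x -> 0 < evalv p z.
Proof.
move=> m0 hx nz z [hz zr] px; rewrite ltNge; apply/negP => pz.
have [w [hw xw ez]] := great_circle m0 hx hz.
have th := dotprod_itv hx hz.
set t := geodesic_dist x z in zr ez.
have t0 : 0 <= t by exact: acos_ge0.
have tpi : t <= pi by exact: acos_lepi.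
pose g (v : R) := evalv p (cos v *: x + sin v *: w).
have cg : {within `[0, t], continuous g}.
  apply: continuous_subspaceT => v; rewrite /g /evalv; apply: continuous_meval => i.
  rewrite (_ : (fun y => _) = fun y => cos y * x 0 i + sin y * w 0 i); last first.
    by apply/funext => y; rewrite !mxE.
  apply: continuousD.
    by apply: (@continuousM R R cos (fun=> x 0 i));
      [exact: continuous_cos|exact: cst_continuous].
  by apply: (@continuousM R R sin (fun=> w 0 i));
    [exact: continuous_sin|exact: cst_continuous].
have g0 : g 0 = evalv p x by rewrite /g cos0 sin0 scale1r scale0r addr0.
have gt : g t = evalv p z by rewrite /g -ez.
have [|v] := IVT t0 cg (v := 0).
  by rewrite g0 gt ge_min le_max pz (ltW px) orbT.
rewrite in_itv /= => /andP[v0 vt] gv.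
have xx : dotprod x x = 1 by []; have ww : dotprod w w = 1 by [].
set u := cos v *: x + sin v *: w in gv.
have xu : dotprod x u = cos v.
  by rewrite dotprodDr !dotprodZr xx xw mulr1 mulr0 addr0.
have : geodesic_ball x r u.
  split.
    rewrite /unit_sphere /= !dotprodDl !dotprodDr !dotprodZl !dotprodZr.
    rewrite (dotprodC w) xx xw ww.
    by rewrite -[RHS](cos2Dsin2 v); ring.
  rewrite /geodesic_dist xu cosK ?in_itv /= ?v0 ?(le_trans vt) //.
by move=> /nz; rewrite -/(g v) in gv *; rewrite gv eqxx.
Qed.

End GreatCircle.

(** * Eliminating the degrees one by one *)

(* Averaging over geodesic spheres whose radius is a root of y_k kills the
   degree k component and shrinks the ball of positivity by that radius. *)
Lemma no_positive_harmonic_sum (R : realType) (m : nat) (l : seq nat)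
    (a : nat -> R) (f : nat -> {mpoly R[m.+1]}) (x : 'rV[R]_m.+1) (r : R) :
    (0 < m)%N -> (forall k, k \in l -> (0 < k)%N) ->
    (forall k, k \in l -> harmonic_polys R m.+1 k (f k)) ->
    unit_sphere x -> pi ^+ 2 * m.+1%:R * \sum_(k <- l) k%:R^-1 <= r ->
    (forall z, geodesic_ball x r z -> 0 < \sum_(k <- l) a k * evalv (f k) z) ->
  False.
Proof.
move=> m0; elim: l a r => [|k l IH] a r l_gt0 hf hx hr pos.
  have /pos : geodesic_ball x r x; last by rewrite big_nil ltxx.
  split=> //; rewrite /geodesic_dist (hx : dotprod x x = 1) acos1.
  by rewrite big_nil mulr0 in hr.
have [|c [c1 yc ct]] := @zonal_root R m k m0; first by apply: l_gt0; rewrite mem_head.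
(* The factors produced by averaging are absorbed into the coefficients, which keeps the form of the
   sum. *)
apply: (IH (fun j => a j * (zonal R m j).[c]) (r - acos c)) => //.
- by move=> j jl; apply: l_gt0; rewrite in_cons jl orbT.
- by move=> j jl; apply: hf; rewrite in_cons jl orbT.
- by move: hr; rewrite big_cons mulrDr; lra.
move=> z [hz zr].
have := @zonal_mean_gt0 R m (k :: l) a f z c m0 hz c1 hf.
rewrite big_cons yc mulr0 mul0r add0r; apply => u hu zu.
apply: pos; split=> //; apply: le_trans (geodesic_dist_triangle hx hz hu) _.
by rewrite {2}/geodesic_dist zu; lra.
Qed.

Theorem theorem2 (R : realType) (d : nat) (d_ge2 : (2 <= d)%N)
    (p : {mpoly R[d]})
    (S : {fset nat}) (S_neq0 : S != fset0)
    (S_gt0 : forall k : nat, k \in S -> (0 < k)%N)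
    (a : nat -> R) (f : nat -> {mpoly R[d]})
    (f_harmonic : forall k : nat, k \in S -> harmonic_polys R d k (f k))
    (p_sphere : forall x : 'rV[R]_d, unit_sphere x ->
       evalv p x = \sum_(k <- S) a k * evalv (f k) x) :
  forall x : 'rV[R]_d, unit_sphere x ->
    exists z : 'rV[R]_d,
      geodesic_ball x (pi ^+ 2 * d%:R * \sum_(k <- S) k%:R^-1) z /\
      evalv p z = 0.
Proof.
case: d d_ge2 p f f_harmonic p_sphere => // m m0 p f f_harmonic p_sphere x hx.
rewrite ltnS in m0; set r := pi ^+ 2 * _ * _.
apply: contrapT => hne.
have nz z : geodesic_ball x r z -> evalv p z != 0.
  by move=> hz; apply/eqP => pz; apply: hne; exists z.
have r0 : 0 <= r.
  apply: mulr_ge0; first by apply: mulr_ge0; rewrite ?sqr_ge0.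
  by apply: sumr_ge0 => k _; rewrite invr_ge0.
have /nz px : geodesic_ball x r x.
  by split=> //; rewrite /geodesic_dist (hx : dotprod x x = 1) acos1.
(* Without a zero, [p] keeps on the ball its sign at the centre; a negative sign is reduced to a
   positive one by negating the coefficients. *)
case: (ltgtP (evalv p x) 0) px => // px _.
- apply: (no_positive_harmonic_sum m0 S_gt0 f_harmonic hx (lexx r) (a := fun k => - a k)).
  move=> z hz; under eq_bigr => k _ do rewrite mulNr.
  rewrite sumrN -(p_sphere z hz.1).
  have evN y : evalv (- p) y = - evalv p y by rewrite /evalv mevalN.
  rewrite -evN; apply: (same_sign_on_ball m0 hx _ hz); last by rewrite evN oppr_gt0.
  by move=> y /nz; rewrite evN oppr_eq0.
apply: (no_positive_harmonic_sum m0 S_gt0 f_harmonic hx (lexx r) (a := a)) => z hz.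
by rewrite -(p_sphere z hz.1); apply: (same_sign_on_ball m0 hx nz hz).
Qed.
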